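(* Let $\mathcal{F}$, $\mathcal{G}$ and $\tilde{\mathcal{G}}$ be nontrivial subspaces of a real or complex Hilbert space $\mathcal{H}$. Then $$\mathrm{dist}\big(\cos^2(\hat{\Theta}(\mathcal{F},\mathcal{G})),\ \cos^2(\hat{\Theta}(\mathcal{F},\tilde{\mathcal{G}}))\big)\le\mathrm{gap}(\mathcal{G},\tilde{\mathcal{G}}).$$
   Context: A subspace means a closed linear manifold; nontrivial means different from $\{0\}$. $P_{\mathcal{F}}$ denotes the orthogonal projector onto $\mathcal{F}$; $\Sigma$ denotes the spectrum; $(P_{\mathcal{F}}P_{\mathcal{G}})|_{\mathcal{F}}$ is regarded as an operator $\mathcal{F}\to\mathcal{F}$. The set of angles from $\mathcal{F}$ to $\mathcal{G}$ is $$\hat{\Theta}(\mathcal{F},\mathcal{G})=\{\theta:\theta=\arccos(\sigma),\ \sigma\ge 0,\ \sigma^2\in\Sigma((P_{\mathcal{F}}P_{\mathcal{G}})|_{\mathcal{F}})\}\subseteq[0,\pi/2].$$ A function applied to a set denotes the image of the set. For bounded real sets $S_1,S_2$, $\mathrm{dist}(S_1,S_2)=\max\{\sup_{u\in S_1}\mathrm{dist}(u,S_2),\sup_{v\in S_2}\mathrm{dist}(v,S_1)\}$ is the Hausdorff distance, where $\mathrm{dist}(u,S)=\inf_{v\in S}|u-v|$. The gap is $\mathrm{gap}(\mathcal{G},\tilde{\mathcal{G}})=\|P_{\mathcal{G}}-P_{\tilde{\mathcal{G}}}\|$ (operator norm). *)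

(* Defs.v *)
From HB Require Import structures.
From mathcomp Require Import all_boot all_order all_algebra.
From mathcomp Require Import sesquilinear complex.
From mathcomp Require Import all_classical all_reals all_analysis.

Set Implicit Arguments.
Unset Strict Implicit.
Unset Printing Implicit Defensive.

Import Order.TTheory GRing.Theory Num.Theory.
Import numFieldNormedType.Exports.

Local Open Scope classical_set_scope.
Local Open Scope ring_scope.

Variant scalar_kind := RealScalars | ComplexScalars.

Definition scalars (R : realType) (k : scalar_kind) : numFieldType :=
  match k with RealScalars => R | ComplexScalars => R[i] end.

Definition scalar_conj (R : realType) (k : scalar_kind) :
    scalars R k -> scalars R k :=
  match k with RealScalars => idfun | ComplexScalars => @Num.conj R[i] end.

Definition scalar_of_real (R : realType) (k : scalar_kind) :
    R -> scalars R k :=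
  match k with RealScalars => idfun | ComplexScalars => real_complex R end.

Definition real_part (R : realType) (k : scalar_kind) : scalars R k -> R :=
  match k with RealScalars => idfun | ComplexScalars => @complex.Re R end.

(* The inner product is linear in its first argument and conjugate-linear in
   its second one; [inner_norm] says that it induces the (complete) norm. *)
Record hilbertType (R : realType) (k : scalar_kind) := HilbertType {
  hilbert_sort :> completeNormedModType (scalars R k);
  inner : {dot hilbert_sort for @scalar_conj R k};
  inner_norm : forall x : hilbert_sort, inner x x = `|x| ^+ 2
}.

Section Hilbert.
Variables (R : realType) (k : scalar_kind) (H : hilbertType R k).
Implicit Types (F G : set H) (x y z : H) (T S : H -> H) (l : scalars R k).

(* The norm of a normed module over [R[i]] takes its values in [R[i]]. *)
Definition hnorm x : R := real_part `|x|.

Definition closed_subspace F : Prop := submod_closed (mem F) /\ closed F.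

Definition nontrivial F : Prop := F <> [set 0].

(* The (unique, by completeness) y in F such that x - y is orthogonal to F. *)
Definition projector F : H -> H := fun x =>
  xget 0 [set y | F y /\ forall z, F z -> inner H (x - y) z = 0].

(* An operator F -> F is represented by a function on H, of which only the
   values on F matter. *)
Definition bounded_operator F T : Prop :=
  [/\ forall x, F x -> F (T x),
      forall l x y, F x -> F y -> T (l *: x + y) = l *: T x + T y
    & exists M : R, forall x, F x -> hnorm (T x) <= M * hnorm x].

Definition invertible F T : Prop :=
  exists S, [/\ bounded_operator F S,
                forall x, F x -> S (T x) = x
              & forall x, F x -> T (S x) = x].

Definition spectrum F T : set (scalars R k) :=
  [set l | ~ invertible F (fun x => T x - l *: x)].

Definition angles F G : set R :=
  [set theta | exists sigma : R,
    [/\ theta = acos sigma, 0 <= sigma &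
        spectrum F (projector F \o projector G) (scalar_of_real k (sigma ^+ 2))]].

Definition operator_norm T : R :=
  sup [set hnorm (T x) | x in [set x | hnorm x <= 1]].

Definition gap G1 G2 : R :=
  operator_norm (fun x => projector G1 x - projector G2 x).

End Hilbert.

Definition dist_to_set (R : realType) (u : R) (S : set R) : R :=
  inf [set `|u - v| | v in S].

Definition hausdorff_dist (R : realType) (S1 S2 : set R) : R :=
  Num.max (sup [set dist_to_set u S2 | u in S1])
          (sup [set dist_to_set v S1 | v in S2]).

(* Main.v *)
Require Import Defs.
From mathcomp Require Import all_boot all_order all_algebra.
From mathcomp Require Import sesquilinear complex ring lra.
From mathcomp Require Import all_classical all_reals all_analysis.

Set Implicit Arguments.
Unset Strict Implicit.
Unset Printing Implicit Defensive.

Import Order.TTheory GRing.Theory Num.Theory.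
Import numFieldNormedType.Exports.

Local Open Scope classical_set_scope.
Local Open Scope ring_scope.

(** Write A and B for the compressions of the projectors onto G and G' to F.
    They are selfadjoint with 0 <= A, B <= 1, so every point of their spectra
    that is the image of a real number lies in [0, 1], and cos^2 of the set of
    angles is exactly the real spectrum ([cos2_angles]).  As
    A x - B x = P_F (P_G x - P_G' x), also |A x - B x| <= gap G G' * |x| on F
    ([hnorm_gap]), and what remains is that spectra of selfadjoint operators
    move by at most the norm of the perturbation
    ([approximate_spectrum_perturbation]).

    Everything is done with the approximate spectrum, the real s for which
    T - s is not bounded below.  For selfadjoint T it is the real spectrum
    ([selfadjoint_spectrum]): if T - s is bounded below then its range is
    closed, and the orthogonal complement of the range is the kernel, which is
    zero.  The key fact ([approximate_spectrum_nearest]) is that the best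
    constant m in m * |x| <= |T x| is attained on the spectrum, as s = m or
    s = - m.  Indeed T^2 - m^2 is positive semidefinite and its form takes
    arbitrarily small values on unit vectors, so by the Cauchy-Schwarz
    inequality for semidefinite forms it is not bounded below, and therefore
    one of its factors T - m, T + m is not.

    Given u in the spectrum of A, apply this to T = B - u.  Since A - u is not
    bounded below and differs from T by at most the gap, m <= gap G G'; so
    u + m or u - m is a point of the spectrum of B within the gap of u.

    Only the norm and the real part of the inner product enter these
    estimates, so real and complex scalars are treated together: [rip]
    makes H a real inner product space in both cases. *)

(** * Scalars *)

Section Scalars.
Variables (R : realType) (k : scalar_kind).
Implicit Types (c d : R) (a b : scalars R k).
Local Notation "c %:S" := (@scalar_of_real R k c) (at level 2, format "c %:S").

Lemma scalar_of_realM c d : (c * d)%:S = c%:S * d%:S.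
Proof. by case: k => //; exact: (rmorphM (real_complex R)) c d. Qed.

Lemma scalar_of_realD c d : (c + d)%:S = c%:S + d%:S.
Proof. by case: k => //; exact: (rmorphD (real_complex R)) c d. Qed.

Lemma scalar_of_realN c : (- c)%:S = - c%:S.
Proof. by case: k => //; exact: (rmorphN (real_complex R)) c. Qed.

Lemma scalar_of_realB c d : (c - d)%:S = c%:S - d%:S.
Proof. by rewrite scalar_of_realD scalar_of_realN. Qed.

Lemma scalar_of_real_gt0 c : (0 < c%:S) = (0 < c).
Proof. by case: k => //; exact: (@ltcR R 0 c). Qed.

Lemma scalar_of_real1 : 1%:S = 1.
Proof. by case: k. Qed.

Lemma real_partK c : real_part c%:S = c.
Proof. by case: k. Qed.

Lemma real_partD a b : real_part (a + b) = real_part a + real_part b.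
Proof. by case: k a b => // [[? ?] [? ?]]. Qed.

Lemma real_partZ c a : real_part (c%:S * a) = c * real_part a.
Proof. by case: k a => //= -[x y]; rewrite /= mul0r subr0. Qed.

Lemma real_part_conj a : real_part (scalar_conj a) = real_part a.
Proof. by case: k a => //= -[x y]. Qed.

Lemma ge0_real_partK a : 0 <= a -> (real_part a)%:S = a.
Proof.
by case: k a => //= a a0; apply: (@RRe_real R); exact: ger0_real.
Qed.

Lemma ler_real_part a b : a <= b -> real_part a <= real_part b.
Proof. by case: k a b => //= a b; rewrite lecE => /andP[]. Qed.

Lemma real_part_conjM a : a != 0 -> 0 < real_part (scalar_conj a * a).
Proof.
case: k a => /= a a0; first by rewrite -expr2 exprn_even_gt0.
case: a a0 => x y; rewrite eq_complex /= => xy0.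
rewrite mulNr opprK -!expr2 lt_neqAle addr_ge0 ?sqr_ge0// andbT eq_sym.
by rewrite paddr_eq0 ?sqr_ge0// !sqrf_eq0.
Qed.

Lemma real_part_norm c : real_part `|c%:S| = `|c|.
Proof.
case: k => //=.
apply: etrans (congr1 (@complex.Re R) (@normc_def R c%:C%C)) _.
by rewrite /= expr0n addr0 sqrtr_sqr.
Qed.
End Scalars.

(** * The underlying real inner product *)

Lemma quadratic_ge0_discriminant (R : realFieldType) (a b c : R) :
  0 <= c -> (forall t, 0 <= a - 2 * t * b + t ^+ 2 * c) -> b ^+ 2 <= a * c.
Proof.
rewrite le_eqVlt => /predU1P[<-|c0] ge0; last first.
  have := ge0 (b / c).
  have -> : a - 2 * (b / c) * b + (b / c) ^+ 2 * c = a - b ^+ 2 / c.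
    by field; rewrite gt_eqF.
  by rewrite subr_ge0 ler_pdivrMr.
rewrite mulr0; apply/contraT; rewrite -ltNge => b0.
have {}b0 : b != 0 by rewrite -sqrf_eq0 gt_eqF.
have := ge0 ((a + 1) / b); have := ge0 0.
have -> : 2 * ((a + 1) / b) * b = 2 * (a + 1) by field.
by lra.
Qed.

Section HilbertGeometry.
Variables (R : realType) (k : scalar_kind) (H : hilbertType R k).
Implicit Types (F : set H) (x y z : H) (T : H -> H) (c e : R).
Local Notation "c %:S" := (@scalar_of_real R k c) (at level 2, format "c %:S").

Definition rip x y : R := real_part (inner H x y).

Lemma innerC x y : inner H x y = scalar_conj (inner H y x).
Proof. by rewrite (hermitian_subproof (s := inner H) x y) expr0 mul1r. Qed.

Lemma innerDl x y z : inner H (x + y) z = inner H x z + inner H y z.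
Proof. exact: linearDl. Qed.

Lemma innerZl a x z : inner H (a *: x) z = a * inner H x z.
Proof. exact: linearZl_LR. Qed.

Lemma ripC x y : rip x y = rip y x.
Proof. by rewrite /rip innerC real_part_conj. Qed.

Lemma ripDl x y z : rip (x + y) z = rip x z + rip y z.
Proof. by rewrite /rip innerDl real_partD. Qed.

Lemma ripZl c x y : rip (c%:S *: x) y = c * rip x y.
Proof. by rewrite /rip innerZl real_partZ. Qed.

Lemma ripNl x y : rip (- x) y = - rip x y.
Proof.
by apply: (addrI (rip x y)); rewrite -ripDl !subrr /rip linear0l; case: (k).
Qed.

Lemma ripBl x y z : rip (x - y) z = rip x z - rip y z.
Proof. by rewrite ripDl ripNl. Qed.

Lemma ripDr x y z : rip x (y + z) = rip x y + rip x z.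
Proof. by rewrite ripC ripDl !(ripC x). Qed.

Lemma ripZr c x y : rip x (c%:S *: y) = c * rip x y.
Proof. by rewrite ripC ripZl (ripC x). Qed.

Lemma ripBr x y z : rip x (y - z) = rip x y - rip x z.
Proof. by rewrite ripC ripBl !(ripC x). Qed.

Lemma norm_hnorm x : `|x| = (hnorm x)%:S.
Proof. by rewrite ge0_real_partK. Qed.

Lemma hnorm_ge0 x : 0 <= hnorm x.
Proof.
by have := ler_real_part (normr_ge0 x); rewrite /hnorm; case: (k) `|x|.
Qed.

Lemma hnorm0 : hnorm (0 : H) = 0.
Proof. by rewrite /hnorm normr0; case: (k). Qed.

Lemma hnorm_eq0 x : hnorm x = 0 -> x = 0.
Proof.
move=> x0; apply/eqP; rewrite -normr_eq0 norm_hnorm x0.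
by apply/eqP; case: (k).
Qed.

Lemma hnormD x y : hnorm (x + y) <= hnorm x + hnorm y.
Proof. by rewrite /hnorm -real_partD; exact/ler_real_part/ler_normD. Qed.

Lemma hdistC x y : hnorm (x - y) = hnorm (y - x).
Proof. by rewrite /hnorm distrC. Qed.

Lemma hnormB x y : hnorm (x - y) <= hnorm x + hnorm y.
Proof. by apply: le_trans (hnormD _ _) _; rewrite /hnorm normrN. Qed.

Lemma hnormZ c x : hnorm (c%:S *: x) = `|c| * hnorm x.
Proof.
rewrite {1}/hnorm normrZ -(real_part_norm k) -real_partZ.
by rewrite ge0_real_partK.
Qed.

Lemma norm_lt x c : (`|x| < c%:S) = (hnorm x < c).
Proof.
rewrite norm_hnorm -subr_gt0 -scalar_of_realB.
by rewrite scalar_of_real_gt0 subr_gt0.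
Qed.

Lemma rip_hnorm x : rip x x = hnorm x ^+ 2.
Proof.
rewrite /rip inner_norm norm_hnorm !expr2.
by rewrite -scalar_of_realM real_partK.
Qed.

(** For an operator that maps a subspace F to itself linearly over the scalars
    this is equivalent to symmetry on F with respect to the full inner product. *)
Definition rip_symmetric F T :=
  forall x y, F x -> F y -> rip (T x) y = rip x (T y).

Section Subspace.
Variable F : set H.
Hypothesis subF : submod_closed (mem F).

Lemma subspace0 : F 0.
Proof. by case: subF => + _; rewrite !inE. Qed.

Lemma subspaceZD a x y : F x -> F y -> F (a *: x + y).
Proof.
by case: subF => _ /(_ a x y) + Fx Fy; rewrite !inE; exact.
Qed.

Lemma subspaceZ a x : F x -> F (a *: x).
Proof.
move=> Fx; rewrite -[_ *: _]addr0.
by apply: subspaceZD => //; exact: subspace0.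
Qed.

Lemma subspaceB x y : F x -> F y -> F (x - y).
Proof. by move=> Fx Fy; rewrite addrC -scaleN1r; exact: subspaceZD. Qed.
End Subspace.


(** The form <T x, y> need not be definite; besides the usual Cauchy-Schwarz
    inequality ([T] the identity), the instance T^2 - m^2 is what locates the
    spectrum of T. *)
Lemma semidefinite_cauchy_schwarz F T : submod_closed (mem F) ->
    (forall (a : scalars R k) x y, F x -> F y ->
      T (a *: x + y) = a *: T x + T y) ->
    rip_symmetric F T -> (forall x, F x -> 0 <= rip (T x) x) ->
  forall x y, F x -> F y -> rip (T x) y ^+ 2 <= rip (T x) x * rip (T y) y.
Proof.
move=> subF linT symT psdT x y Fx Fy.
apply: quadratic_ge0_discriminant => [|t]; first exact: psdT.
have := psdT ((- t)%:S *: y + x) (subspaceZD subF _ Fy Fx).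
rewrite linT // !(ripDl, ripDr, ripZl, ripZr) (symT y x) // (ripC y (T x)).
by congr (0 <= _); ring.
Qed.

Lemma normr_rip_le x y : `|rip x y| <= hnorm x * hnorm y.
Proof.
have subT : submod_closed (mem [set: H]) by split=> [|a u v _ _]; rewrite !inE.
rewrite -(@ler_pXn2r _ 2) ?nnegrE ?mulr_ge0 ?hnorm_ge0//.
rewrite real_normK ?num_real// exprMn -!rip_hnorm.
apply: (semidefinite_cauchy_schwarz (T := id) subT) => // z _.
by rewrite rip_hnorm sqr_ge0.
Qed.

(** * Completeness and projections *)

(** [Q e y] stands for: y solves some problem up to an error e.  When the
    approximate solutions are as close to each other as their errors, those of
    errors tending to 0 form a Cauchy sequence.  The limit comes with arbitrarily
    good approximate solutions nearby, from which the exact problem is solved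
    by an estimate.  It serves both for projections and for closed ranges. *)
Lemma limit_of_approximations (P : set H) (Q : R -> H -> Prop) :
    closed P -> (forall e, 0 < e -> exists2 y, P y & Q e y) ->
    (forall d e y z, 0 < d -> 0 < e -> P y -> P z -> Q d y -> Q e z ->
      hnorm (y - z) <= d + e) ->
  exists2 y, P y & forall e, 0 < e ->
    exists d z, [/\ d <= e, P z, Q d z & hnorm (y - z) < e].
Proof.
move=> clP exQ cauchyQ.
have /choice[u uP] : forall n : nat, exists y, P y /\ Q n.+1%:R^-1 y.
  move=> n; have [|y] := exQ n.+1%:R^-1; last by exists y.
  by rewrite invr_gt0 ltr0n.
have smallV e : 0 < e -> exists N, forall n, (N <= n)%N -> n.+1%:R^-1 < e.
  move=> e0; exists (Num.truncn e^-1) => n Nn; rewrite invf_plt ?posrE ?ltr0n//.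
  apply: lt_le_trans (truncnS_gt _) _; by rewrite ler_nat ltnS.
have cu : cauchy (u @ \oo).
  apply: cauchy_exP => eps eps0.
  have e0 : 0 < real_part eps.
    by rewrite -(scalar_of_real_gt0 k) ge0_real_partK // ltW.
  have [N NP] := smallV (real_part eps / 2) ltac:(by lra).
  exists (u N); exists N => // n /= Nn.
  rewrite -ball_normE /ball_ /=.
  rewrite -(ge0_real_partK (ltW eps0)) norm_lt.
  apply: le_lt_trans
    (cauchyQ _ _ _ _ _ _ (uP N).1 (uP n).1 (uP N).2 (uP n).2) _;
    rewrite ?invr_gt0 ?ltr0n//.
  by rewrite [ltRHS]splitr ltrD ?NP.
have ul : u @ \oo --> lim (u @ \oo) by exact: cauchy_cvg.
exists (lim (u @ \oo)).
  apply: (closed_cvg _ clP) ul.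
  by apply: nearW => n; exact: (uP n).1.
move=> e e0; have [N NP] := smallV e e0.
have eS : 0 < e%:S by rewrite scalar_of_real_gt0.
have /cvgrPdist_lt /(_ _ eS) [M _ MP] := ul.
have [Pu Qu] := uP (maxn M N).
exists (maxn M N).+1%:R^-1, (u (maxn M N)); split=> //.
  by apply/ltW/NP; exact: leq_maxr.
by rewrite -norm_lt; apply: MP; rewrite /= leq_maxl.
Qed.

Lemma le0_small (a C : R) : 0 <= C -> (forall e, 0 < e -> a <= e * C) -> a <= 0.
Proof.
move=> C0 aC; rewrite leNgt; apply/negP => a0.
have C1 : 0 < C + 1 by lra.
have := aC (a / (C + 1)) (divr_gt0 a0 C1).
by rewrite mulrAC ler_pdivlMr // mulrDr mulr1; lra.
Qed.

(** A point y of F that minimizes |x - y|^2 up to e^2 works: moving y along z cannot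
    lower |x - y|^2 by more than e^2, and the discriminant of this quadratic
    inequality is the claim.  Stated for inner products rather than distances,
    it makes the Cauchy property of the minimizing sequence immediate. *)
Lemma approximate_projection F x e : submod_closed (mem F) -> 0 < e ->
  exists2 y, F y & forall z, F z -> `|rip (x - y) z| <= e * hnorm z.
Proof.
move=> subF e0; pose E := [set hnorm (x - y) ^+ 2 | y in F].
have infE : has_inf E.
  split; first by exists (hnorm (x - 0) ^+ 2), 0 => //; exact: subspace0.
  by exists 0 => _ [y _ <-]; exact: sqr_ge0.
have [_ [y Fy <-] ylt] := inf_adherent (exprn_gt0 2 e0) infE.
exists y => // z Fz.
rewrite -(@ler_pXn2r _ 2) ?nnegrE ?mulr_ge0 ?hnorm_ge0 ?(ltW e0)//.
rewrite real_normK ?num_real// exprMn.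
apply: quadratic_ge0_discriminant => [|t]; first exact: sqr_ge0.
have : inf E <= hnorm (x - (t%:S *: z + y)) ^+ 2.
  by apply: (ge_inf infE.2); exists (t%:S *: z + y) => //; exact: subspaceZD.
have -> : x - (t%:S *: z + y) = (x - y) - t%:S *: z.
  by rewrite opprD addrA addrAC.
move: ylt; rewrite -!rip_hnorm; move: (x - y) => w.
rewrite (ripBl w) !ripBr !ripZl !ripZr (ripC z w).
by move: (inf E) => m; nra.
Qed.

(** Orthogonality for the real part, tested on the multiple of z by the conjugate
    of <z, x>, gives orthogonality for the inner product. *)
Lemma rip_orthogonal_inner F x : submod_closed (mem F) ->
  (forall z, F z -> rip x z = 0) -> forall z, F z -> inner H x z = 0.
Proof.
move=> subF xF z Fz; apply/eqP/contraT => xz0.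
have a0 : inner H z x != 0.
  apply: contra_neq xz0 => zx.
  by rewrite innerC zx; case: (k); rewrite /= ?conjC0.
have := real_part_conjM a0.
have := xF _ (subspaceZ subF (scalar_conj (inner H z x)) Fz).
by rewrite ripC /rip innerZl => ->; rewrite ltxx.
Qed.

Lemma projection_theorem F x : closed_subspace F ->
  exists y, F y /\ forall z, F z -> inner H (x - y) z = 0.
Proof.
move=> [subF clF].
pose Q e y := forall z, F z -> `|rip (x - y) z| <= e * hnorm z.
have [|d e y z d0 e0 Fy Fz Qy Qz|y Fy yP] := @limit_of_approximations F Q clF.
- by move=> e; exact: approximate_projection.
- have Fyz := subspaceB subF Fy Fz.
  have [->|yz0] := eqVneq (y - z) 0; first by rewrite hnorm0; lra.
  have yz : 0 < hnorm (y - z).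
    rewrite lt_neqAle hnorm_ge0 andbT eq_sym.
    by apply: contra_neq yz0; exact: hnorm_eq0.
  rewrite -(ler_pM2r yz) -expr2 -rip_hnorm.
  have -> : rip (y - z) (y - z) = rip (x - z) (y - z) - rip (x - y) (y - z).
    by rewrite -ripBl opprB [x - z + _]addrC addrA addrNK.
  have := Qy _ Fyz; have := Qz _ Fyz; rewrite !ler_norml mulrDl; lra.
exists y; split=> //; apply: rip_orthogonal_inner => // z Fz.
apply/eqP; rewrite -normr_le0; apply: (@le0_small _ (2 * hnorm z)) => [|e e0].
  by rewrite mulr_ge0 ?hnorm_ge0.
have [d [w [de Fw Qw yw]]] := yP e e0.
have -> : x - y = (x - w) - (y - w) by rewrite opprB addrA addrNK.
rewrite ripBl; apply: le_trans (ler_normB _ _) _.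
have := Qw z Fz; have := normr_rip_le (y - w) z; have := hnorm_ge0 z.
nra.
Qed.

Section Projector.
Variable F : set H.
Hypothesis clF : closed_subspace F.

Lemma projector_spec x :
  F (projector F x) /\ forall z, F z -> inner H (x - projector F x) z = 0.
Proof. exact: (xgetPex 0 (projection_theorem x clF)). Qed.

Lemma projector_in x : F (projector F x).
Proof. by case: (projector_spec x). Qed.

Lemma rip_projector x z : F z -> rip (projector F x) z = rip x z.
Proof.
move=> Fz; apply/esym/eqP; rewrite -subr_eq0 -ripBl /rip.
by rewrite (projector_spec x).2 //; case: (k).
Qed.

Lemma projector_unique x y :
  F y -> (forall z, F z -> inner H (x - y) z = 0) -> projector F x = y.
Proof.
move=> Fy xy; apply/eqP; rewrite -subr_eq0; apply/eqP/hnorm_eq0/eqP.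
have Fd := subspaceB clF.1 (projector_in x) Fy.
rewrite -sqrf_eq0 -rip_hnorm.
rewrite {1}(_ : projector F x - y = (x - y) - (x - projector F x)).
  by rewrite ripBl /rip xy // (projector_spec x).2 // subrr; case: (k).
by rewrite opprB [x - y + _]addrC addrA addrNK.
Qed.

Lemma projector_linear a x y :
  projector F (a *: x + y) = a *: projector F x + projector F y.
Proof.
apply: projector_unique => [|z Fz].
  by apply: subspaceZD (projector_in _) (projector_in _); case: clF.
rewrite opprD addrACA -scalerBr innerDl innerZl.
by rewrite !(projector_spec _).2 // mulr0 addr0.
Qed.

Lemma hnorm_projector x : hnorm (projector F x) <= hnorm x.
Proof.
have [->|p0] := eqVneq (hnorm (projector F x)) 0; first exact: hnorm_ge0.
have p_gt0 : 0 < hnorm (projector F x) by rewrite lt_neqAle eq_sym p0 hnorm_ge0.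
rewrite -(ler_pM2r p_gt0) -expr2 -rip_hnorm.
rewrite rip_projector; last exact: projector_in.
exact: le_trans (ler_norm _) (normr_rip_le _ _).
Qed.

Lemma projector_symmetric x y : rip (projector F x) y = rip x (projector F y).
Proof.
rewrite ripC -(rip_projector y (projector_in x)) ripC rip_projector //.
exact: projector_in.
Qed.
End Projector.

(** * Selfadjoint operators *)

Definition selfadjoint F T := bounded_operator F T /\ rip_symmetric F T.

Lemma bounded_operator_gt0 F T : bounded_operator F T ->
  exists2 M : R, 0 < M & forall x, F x -> hnorm (T x) <= M * hnorm x.
Proof.
case=> _ _ [M MP]; exists (`|M| + 1) => [|x Fx]; first by rewrite ltr_wpDl.
apply: le_trans (MP x Fx) _.
by rewrite ler_wpM2r ?hnorm_ge0 // (le_trans (ler_norm _)) // lerDl.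
Qed.

Lemma bounded_operatorB F T x y :
  bounded_operator F T -> F x -> F y -> T (x - y) = T x - T y.
Proof.
move=> [_ linT _] Fx Fy.
by rewrite [x - y]addrC -scaleN1r linT // scaleN1r addrC.
Qed.

Lemma bounded_operatorZ F T a x : submod_closed (mem F) ->
  bounded_operator F T -> F x -> T (a *: x) = a *: T x.
Proof.
move=> subF boT Fx; have F0 := subspace0 subF.
have T0 : T 0 = 0 by have := bounded_operatorB boT F0 F0; rewrite !subrr.
by case: boT => _ linT _; rewrite -[_ *: x]addr0 linT // T0 addr0.
Qed.

Section Selfadjoint.
Variables (F : set H) (T : H -> H).
Hypotheses (clF : closed_subspace F) (saT : selfadjoint F T).

Lemma selfadjoint_shift c : selfadjoint F (fun x => T x - c%:S *: x).
Proof.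
have [[stabT linT _] symT] := saT; have [M M0 MP] := bounded_operator_gt0 saT.1.
split; first split.
- by move=> x Fx; apply: subspaceB (stabT _ Fx) (subspaceZ _ _ Fx); case: clF.
- move=> l x y Fx Fy; rewrite linT // !scalerDr scalerN opprD addrACA.
  by rewrite !scalerA [c%:S * l]mulrC.
- exists (M + `|c|) => x Fx; apply: le_trans (hnormB _ _) _.
  by rewrite hnormZ mulrDl lerD2r MP.
- by move=> x y Fx Fy; rewrite ripBl ripBr symT // ripZl ripZr.
Qed.

Lemma selfadjoint_square : selfadjoint F (T \o T).
Proof.
have [[stabT linT _] symT] := saT; have [M M0 MP] := bounded_operator_gt0 saT.1.
split; first split=> /=.
- by move=> x Fx; exact/stabT/stabT.
- by move=> l x y Fx Fy; rewrite linT // linT //; exact: stabT.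
- exists (M * M) => x Fx; apply: le_trans (MP _ (stabT _ Fx)) _.
  by rewrite -mulrA ler_wpM2l ?(ltW M0) ?MP.
- by move=> x y Fx Fy /=; rewrite symT ?symT //; exact: stabT.
Qed.

End Selfadjoint.

Definition bounded_below F T :=
  exists2 c : R, 0 < c & forall x, F x -> c * hnorm x <= hnorm (T x).

Lemma invertible_bounded_below F T :
  bounded_operator F T -> invertible F T -> bounded_below F T.
Proof.
move=> [stabT _ _] [S [/bounded_operator_gt0 [M M0 MP] SK _]].
exists M^-1 => [|x Fx]; first by rewrite invr_gt0.
by rewrite ler_pdivrMl // -{1}(SK x Fx) MP //; exact: stabT.
Qed.

(** Being bounded below makes approximate preimages of a point as close to each
    other as their errors, up to the factor c. *)
Lemma closed_range F T : closed_subspace F -> bounded_operator F T ->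
  bounded_below F T -> closed_subspace [set T x | x in F].
Proof.
move=> [subF clF] boT [c c0 cP]; have [stabT linT _] := boT.
have TB x y := @bounded_operatorB F T x y boT.
have [M M0 MP] := bounded_operator_gt0 boT.
have F0 := subspace0 subF.
split.
  split=> [|a u v]; rewrite !inE.
    by exists 0 => //; have := TB 0 0 F0 F0; rewrite !subrr.
  move=> [x Fx <-] [y Fy <-]; exists (a *: x + y); last exact: linT.
  exact: subspaceZD.
move=> y cly.
pose Q e x := hnorm (T x - y) <= c * e.
have [|d e x z d0 e0 Fx Fz Qx Qz|x Fx xP] := @limit_of_approximations F Q clF.
- move=> e e0; have ce0 : 0 < c * e by exact: mulr_gt0.
  have [|_ [[x Fx <-]]] := cly (ball y (c * e)%:S).
    by apply: nbhsx_ballx; rewrite scalar_of_real_gt0.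
  rewrite -ball_normE /ball_ /= norm_lt hdistC => /ltW Tx.
  by exists x.
- rewrite -(ler_pM2l c0); apply: le_trans (cP _ (subspaceB subF Fx Fz)) _.
  rewrite TB // (_ : T x - T z = (T x - y) - (T z - y)).
    by rewrite mulrDr; apply: le_trans (hnormB _ _) (lerD Qx Qz).
  by rewrite opprB addrA addrNK.
exists x => //; apply/eqP; rewrite -subr_eq0; apply/eqP/hnorm_eq0/eqP.
rewrite eq_le hnorm_ge0 andbT.
apply: (@le0_small _ (M + c)) => [|e e0]; first by rewrite addr_ge0 ?ltW.
have [d [z [de Fz Qz xz]]] := xP e e0.
have -> : T x - y = T (x - z) + (T z - y) by rewrite TB // addrA addrNK.
apply: le_trans (hnormD _ _) _; rewrite mulrDr lerD //.
  apply: le_trans (MP _ (subspaceB subF Fx Fz)) _.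
  by rewrite mulrC ler_wpM2r ?ltW.
by apply: le_trans Qz _; rewrite mulrC ler_wpM2r ?(ltW c0).
Qed.

(** The range is closed, and a vector q orthogonal to it satisfies
    |T q|^2 = <q, T (T q)> = 0, hence q = 0; so the range is all of F. *)
Lemma selfadjoint_invertible F T : closed_subspace F -> selfadjoint F T ->
  bounded_below F T -> invertible F T.
Proof.
move=> clF saT bbT; have [subF _] := clF; have [[stabT linT _] symT] := saT.
have TB x y := @bounded_operatorB F T x y saT.1.
have clE := closed_range clF saT.1 bbT; have [c c0 cP] := bbT.
have T0 x : F x -> T x = 0 -> x = 0.
  move=> Fx Tx0; apply: hnorm_eq0; apply/eqP.
  have := cP x Fx; rewrite Tx0 hnorm0 pmulr_rle0 // => x0.
  by rewrite eq_le x0 hnorm_ge0.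
have Tinj x y : F x -> F y -> T x = T y -> x = y.
  move=> Fx Fy Txy; apply/eqP; rewrite -subr_eq0; apply/eqP/T0.
    exact: subspaceB.
  by rewrite TB // Txy subrr.
have surjT y : F y -> exists x, F x /\ T x = y.
  move=> Fy; have [x Fx Tx] := projector_in clE y.
  exists x; split=> //; apply/eqP; rewrite eq_sym -subr_eq0; apply/eqP.
  have Fq : F (y - T x) by apply: subspaceB => //; exact: stabT.
  apply: T0 => //; apply: hnorm_eq0; apply/eqP.
  rewrite -sqrf_eq0 -rip_hnorm symT //; last exact: stabT.
  rewrite ripBl Tx rip_projector ?subrr //.
  exists (T (y - projector [set T x | x in F] y)) => //.
  by apply: stabT; rewrite -Tx.
pose S y := xget 0 [set x | F x /\ T x = y].
have SP y : F y -> F (S y) /\ T (S y) = y.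
  by move=> Fy; exact: (xgetPex 0 (surjT y Fy)).
exists S; split.
- split.
  + by move=> x /SP[].
  + move=> l x y Fx Fy; have [[FSx TSx] [FSy TSy]] := (SP x Fx, SP y Fy).
    have [FS TS] := SP _ (subspaceZD subF l Fx Fy).
    by apply: Tinj => //; [exact: subspaceZD|rewrite TS linT // TSx TSy].
  + exists c^-1 => x Fx; have [FSx TSx] := SP x Fx.
    by rewrite ler_pdivlMl // -[X in _ <= hnorm X]TSx cP.
- by move=> x Fx; have [FS TS] := SP _ (stabT x Fx); exact: Tinj.
- by move=> x /SP[].
Qed.

(** * The approximate spectrum *)

Definition approximate_spectrum F T : set R :=
  [set s | ~ bounded_below F (fun x => T x - s%:S *: x)].

Lemma selfadjoint_spectrum F T : closed_subspace F -> selfadjoint F T ->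
  [set s | spectrum F T s%:S] = approximate_spectrum F T.
Proof.
move=> clF saT; have saTs s := selfadjoint_shift clF saT s.
apply/seteqP; split=> s /= sP; apply: contra_not sP.
  exact: selfadjoint_invertible.
by apply: invertible_bounded_below; case: (saTs s).
Qed.

(** Cauchy-Schwarz for the form <T x, y>, at y = T x, reads
    |T x|^4 <= <T x, x> <T (T x), T x> <= <T x, x> M |T x|^2; so <T x, x>
    controls |T x|^2, which controls |x|^2. *)
Lemma semidefinite_bounded_below F T : closed_subspace F -> selfadjoint F T ->
    (forall x, F x -> 0 <= rip (T x) x) -> bounded_below F T ->
  exists2 d : R, 0 < d & forall x, F x -> d * hnorm x ^+ 2 <= rip (T x) x.
Proof.
move=> [subF _] [boT symT] psdT [c c0 cP].
have [M M0 MP] := bounded_operator_gt0 boT; have [stabT linT _] := boT.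
exists (c ^+ 2 / M) => [|x Fx]; first by rewrite divr_gt0 ?exprn_gt0.
have FTx := stabT x Fx.
have cx := cP x Fx; have x_ge0 := hnorm_ge0 x; have Tx_ge0 := hnorm_ge0 (T x).
rewrite mulrAC ler_pdivrMr //.
have cx2 : c ^+ 2 * hnorm x ^+ 2 <= hnorm (T x) ^+ 2.
  by rewrite -exprMn ler_pXn2r ?nnegrE ?mulr_ge0 // ltW.
apply: le_trans cx2 _.
have [->|Tx0] := eqVneq (hnorm (T x)) 0.
  by rewrite expr0n /= mulr_ge0 ?psdT ?ltW.
have Tx2 : 0 < hnorm (T x) ^+ 2 by rewrite exprn_even_gt0.
rewrite -(ler_pM2r Tx2) -expr2 -{1}rip_hnorm.
apply: le_trans (semidefinite_cauchy_schwarz subF linT symT psdT Fx FTx) _.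
rewrite -mulrA ler_wpM2l ?psdT //.
apply: le_trans (ler_norm _) (le_trans (normr_rip_le _ _) _).
by rewrite expr2 mulrA ler_wpM2r // MP.
Qed.

(** The distance from 0 to the spectrum of T is at most |s|, while |s| is a lower
    bound for T: it is the infimum m of |T x| on the unit sphere of F.  If T - m
    and T + m were both bounded below, so would be T^2 - m^2, and with it its
    quadratic form |T x|^2 - m^2 |x|^2, against the choice of m. *)
Lemma approximate_spectrum_nearest F T x0 :
    closed_subspace F -> F x0 -> x0 <> 0 -> selfadjoint F T ->
  exists2 s, approximate_spectrum F T s &
    forall x, F x -> `|s| * hnorm x <= hnorm (T x).
Proof.
move=> clF Fx0 x0_neq0 saT; have [subF _] := clF.
have [[stabT linT _] symT] := saT.
pose E := [set hnorm (T x) | x in [set x | F x /\ hnorm x = 1]].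
have normalize x : F x -> x <> 0 ->
    0 < hnorm x /\ F ((hnorm x)^-1%:S *: x) /\ hnorm ((hnorm x)^-1%:S *: x) = 1.
  move=> Fx xn0; have x_gt0 : 0 < hnorm x.
    by rewrite lt_neqAle hnorm_ge0 andbT; apply/eqP => x0'; exact/xn0/hnorm_eq0.
  split=> //; split; first exact: subspaceZ.
  by rewrite hnormZ ger0_norm ?invr_ge0 ?hnorm_ge0// mulVf ?gt_eqF.
have E0 : E !=set0.
  have [_ nx0] := normalize x0 Fx0 x0_neq0.
  by exists (hnorm (T ((hnorm x0)^-1%:S *: x0))), ((hnorm x0)^-1%:S *: x0).
have lbE : has_lbound E by exists 0 => _ [x _ <-]; exact: hnorm_ge0.
pose m := inf E.
have m0 : 0 <= m by apply: lb_le_inf => // _ [x _ <-]; exact: hnorm_ge0.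
have mP x : F x -> m * hnorm x <= hnorm (T x).
  move=> Fx; have [->|/eqP xn0] := eqVneq x 0.
    by rewrite hnorm0 mulr0 hnorm_ge0.
  have [x_gt0 [Fy y1]] := normalize x Fx xn0.
  have := ge_inf lbE (ex_intro2 _ _ _ (conj Fy y1) erefl).
  rewrite (bounded_operatorZ _ subF saT.1) // hnormZ.
  by rewrite ger0_norm ?invr_ge0 ?hnorm_ge0// ler_pdivlMl // mulrC.
suff [s sm sP] : exists2 s, `|s| = m & approximate_spectrum F T s.
  by exists s => // x Fx; rewrite sm mP.
apply: contrapT => /forall2NP noS.
have bb s : `|s| = m -> bounded_below F (fun x => T x - s%:S *: x).
  by move=> sm; have [//|/contrapT] := noS s.
have [c1 c1_gt0 c1P] := bb m (ger0_norm m0).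
have [c2 c2_gt0 c2P] := bb (- m) ltac:(by rewrite normrN ger0_norm).
(* Q = T^2 - m^2 *)
pose Q x := (T \o T) x - (m ^+ 2)%:S *: x.
have saQ : selfadjoint F Q := selfadjoint_shift clF (selfadjoint_square saT) _.
have ripQ x : F x -> rip (Q x) x = hnorm (T x) ^+ 2 - m ^+ 2 * hnorm x ^+ 2.
  move=> Fx; rewrite ripBl ripZl /= symT //; last exact: stabT.
  by rewrite !rip_hnorm.
have psdQ x : F x -> 0 <= rip (Q x) x.
  move=> Fx; rewrite ripQ // subr_ge0 -exprMn.
  rewrite ler_pXn2r ?nnegrE ?hnorm_ge0 ?mP //.
  by rewrite mulr_ge0 ?hnorm_ge0.
have bbQ : bounded_below F Q.
  exists (c1 * c2) => [|x Fx]; first exact: mulr_gt0.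
  (* Q = (T - m) (T + m) *)
  pose y := T x - (- m)%:S *: x.
  have Fy : F y by apply: subspaceB (stabT _ Fx) (subspaceZ _ _ Fx).
  have -> : Q x = T y - m%:S *: y.
    rewrite /Q /y (bounded_operatorB saT.1) //; [|exact: stabT|exact: subspaceZ].
    rewrite (bounded_operatorZ _ subF saT.1) // scalerBr scalerA.
    rewrite -scalar_of_realM mulrN -expr2.
    by rewrite !scalar_of_realN !scaleNr !opprK opprD addrA addrK.
  apply: le_trans _ (c1P y Fy); rewrite -mulrA ler_wpM2l ?(ltW c1_gt0) //.
  exact: c2P.
have [d d0 dP] := semidefinite_bounded_below clF saQ psdQ bbQ.
(* d is a gain over the infimum: |T x|^2 >= m^2 + d for every unit vector *)
have : Num.sqrt (m ^+ 2 + d) <= m.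
  apply: lb_le_inf => // _ [x [Fx x1] <-].
  rewrite -(ger0_norm (hnorm_ge0 (T x))) -sqrtr_sqr ler_sqrt ?sqr_ge0//.
  by have := dP x Fx; rewrite ripQ // x1 expr1n; lra.
rewrite -{2}(ger0_norm m0) -sqrtr_sqr ler_sqrt ?sqr_ge0//; lra.
Qed.

Lemma nontrivial_neq0 F : closed_subspace F -> nontrivial F ->
  exists2 x, F x & x <> 0.
Proof.
move=> [subF _] ntF; apply: contrapT => /forall2NP no; apply: ntF.
apply/seteqP; split=> [x Fx|_ ->]; last exact: subspace0.
by have [//|/contrapT] := no x.
Qed.

(** Take the nearest point s for B - u.  Then B - u is bounded below by |s|, so
    |s| > g would make A - u bounded below by |s| - g. *)
Lemma approximate_spectrum_perturbation F A B (g u : R) :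
    closed_subspace F -> nontrivial F -> selfadjoint F B ->
    (forall x, F x -> hnorm (A x - B x) <= g * hnorm x) ->
    approximate_spectrum F A u ->
  exists2 v, approximate_spectrum F B v & `|u - v| <= g.
Proof.
move=> clF ntF saB ABg uA.
have [x0 Fx0 x0_neq0] := nontrivial_neq0 clF ntF.
have [s sP sle] := approximate_spectrum_nearest clF Fx0 x0_neq0
  (selfadjoint_shift clF saB u).
exists (u + s).
  apply: contra_not sP => -[c c0 cP]; exists c => // x Fx.
  by rewrite -addrA -opprD -scalerDl -scalar_of_realD; exact: cP.
rewrite opprD addrA subrr sub0r normrN leNgt; apply/negP => gs.
apply: uA; exists (`|s| - g) => [|x Fx]; first by rewrite subr_gt0.
rewrite mulrBl lerBlDr; apply: le_trans (sle x Fx) _.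
have -> : B x - u%:S *: x = (A x - u%:S *: x) - (A x - B x).
  by rewrite opprB [A x - _ + _]addrC addrA addrNK.
by apply: le_trans (hnormB _ _) _; rewrite lerD2l ABg.
Qed.

Lemma approximate_spectrum_ge0 F T : (forall x, F x -> 0 <= rip (T x) x) ->
  forall s, approximate_spectrum F T s -> 0 <= s.
Proof.
move=> psdT s sP; rewrite leNgt; apply/negP => s0; apply: sP.
exists (- s) => [|x Fx]; first by rewrite oppr_gt0.
have [->|x0] := eqVneq (hnorm x) 0; first by rewrite mulr0 hnorm_ge0.
have x_gt0 : 0 < hnorm x by rewrite lt_neqAle eq_sym x0 hnorm_ge0.
rewrite -(ler_pM2r x_gt0); apply: le_trans _ (normr_rip_le _ _).
apply: le_trans _ (ler_norm _); rewrite ripBl ripZl rip_hnorm.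
by have := psdT x Fx; lra.
Qed.

Lemma approximate_spectrum_le1 F T :
    (forall x, F x -> hnorm (T x) <= hnorm x) ->
  forall s, approximate_spectrum F T s -> s <= 1.
Proof.
move=> T1 s sP; rewrite leNgt; apply/negP => s1; apply: sP.
exists (s - 1) => [|x Fx]; first by rewrite subr_gt0.
have : hnorm (s%:S *: x) <= hnorm (T x) + hnorm (T x - s%:S *: x).
  by rewrite -{1}[s%:S *: x](subKr (T x)) hnormB.
by rewrite hnormZ gtr0_norm; have := T1 x Fx; lra.
Qed.

(** * Angles and gap *)

Section Angles.
Variables F G : set H.
Hypotheses (clF : closed_subspace F) (clG : closed_subspace G).
Local Notation A := (projector F \o projector G).

Lemma compression_selfadjoint : selfadjoint F A.
Proof.
split; first split=> /=.
- by move=> x _; exact: projector_in.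
- by move=> l x y _ _; rewrite !projector_linear.
- exists 1 => x _; rewrite mul1r.
  exact: le_trans (hnorm_projector clF _) (hnorm_projector clG _).
- move=> x y Fx Fy /=.
  rewrite rip_projector // projector_symmetric //.
  by rewrite [RHS]ripC rip_projector // ripC.
Qed.

Lemma compression_ge0 x : F x -> 0 <= rip (A x) x.
Proof.
move=> Fx; rewrite /= rip_projector // ripC.
by rewrite -(rip_projector clG x (projector_in clG x)) rip_hnorm sqr_ge0.
Qed.

(** The bounds 0 <= A <= 1 keep the spectrum in [0, 1], where acos inverts cos. *)
Lemma cos2_angles :
  [set cos theta ^+ 2 | theta in angles F G] = approximate_spectrum F A.
Proof.
have specA := selfadjoint_spectrum clF compression_selfadjoint.
have spec01 s : approximate_spectrum F A s -> 0 <= s <= 1.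
  move=> sP; rewrite (approximate_spectrum_ge0 compression_ge0 sP).
  apply: (approximate_spectrum_le1 _ sP) => x _.
  exact: le_trans (hnorm_projector clF _) (hnorm_projector clG _).
rewrite -specA; apply/seteqP; split=> s /=.
  move=> [theta [sigma [-> sigma0 sigmaP]] <-].
  have /spec01/andP[_ sigma1] : approximate_spectrum F A (sigma ^+ 2).
    by rewrite -specA.
  have {}sigma1 : sigma <= 1.
    by rewrite -(@ler_pXn2r _ 2) ?nnegrE // expr1n.
  by rewrite acosK // in_itv /= sigma1 andbT; lra.
move=> sP.
have /spec01/andP[s0 s1] : approximate_spectrum F A s by rewrite -specA.
exists (acos (Num.sqrt s)); first by exists (Num.sqrt s); rewrite sqr_sqrtr.
rewrite acosK ?sqr_sqrtr // in_itv /=.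
have := sqrtr_ge0 s; rewrite -{2}sqrtr1 ler_sqrt //; lra.
Qed.
End Angles.

(** The supremum defining the gap is over a bounded set, as projectors are
    contractions; without a bound it would be the default value 0. *)
Lemma hnorm_gap G G' x : closed_subspace G -> closed_subspace G' ->
  hnorm (projector G x - projector G' x) <= gap G G' * hnorm x.
Proof.
move=> clG clG'.
pose D y := projector G y - projector G' y.
have DZ a y : D (a *: y) = a *: D y.
  have P0 (K : set H) : closed_subspace K -> projector K 0 = 0.
    move=> clK; apply: hnorm_eq0; apply/eqP; rewrite eq_le hnorm_ge0 andbT.
    by rewrite (le_trans (hnorm_projector clK 0)) // hnorm0.
  rewrite /D -[a *: y]addr0 !projector_linear //.
  by rewrite !P0 // !addr0 scalerBr.
have ubD : has_ubound [set hnorm (D y) | y in [set y | hnorm y <= 1]].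
  exists (1 + 1) => _ [y /= y1 <-]; apply: le_trans (hnormB _ _) _.
  by rewrite lerD // (le_trans (hnorm_projector _ _)).
have [x0|x0] := eqVneq (hnorm x) 0.
  have D0 : D 0 = 0 by rewrite -[0 in LHS](scale0r (0 : H)) DZ scale0r.
  by rewrite (hnorm_eq0 x0) -/(D 0) D0 hnorm0 mulr0.
have x_gt0 : 0 < hnorm x by rewrite lt_neqAle eq_sym x0 hnorm_ge0.
have -> : projector G x - projector G' x =
    (hnorm x)%:S *: D ((hnorm x)^-1%:S *: x).
  by rewrite DZ scalerA -scalar_of_realM mulfV // scalar_of_real1 scale1r.
rewrite hnormZ ger0_norm ?hnorm_ge0 // mulrC ler_wpM2r ?hnorm_ge0 //.
apply: (ub_le_sup ubD); exists ((hnorm x)^-1%:S *: x) => //=.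
by rewrite hnormZ ger0_norm ?invr_ge0 ?hnorm_ge0// mulVf.
Qed.

End HilbertGeometry.

(** * Hausdorff distance of the spectra *)

Lemma sup_dist_to_set_le (R : realType) (S1 S2 : set R) (g : R) : 0 <= g ->
    (forall u, S1 u -> exists2 v, S2 v & `|u - v| <= g) ->
  sup [set dist_to_set u S2 | u in S1] <= g.
Proof.
move=> g0 S12; have [->|S10] := eqVneq S1 set0.
  by rewrite image_set0 sup0.
apply: ge_sup; first exact/image_nonempty/set0P.
move=> _ [u S1u <-]; have [v S2v uv] := S12 u S1u.
apply: le_trans uv; apply: ge_inf; last by exists v.
by exists 0 => _ [w _ <-]; exact: normr_ge0.
Qed.

Theorem theorem4p1 (R : realType) (k : scalar_kind) (H : hilbertType R k)
    (F G G' : set H)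
    (hF : closed_subspace F) (F_nontrivial : nontrivial F)
    (hG : closed_subspace G) (G_nontrivial : nontrivial G)
    (hG' : closed_subspace G') (G'_nontrivial : nontrivial G') :
  hausdorff_dist [set cos theta ^+ 2 | theta in angles F G]
                 [set cos theta ^+ 2 | theta in angles F G']
  <= gap G G'.
Proof.
have gap0 : 0 <= gap G G'.
  have [x _ x0] := nontrivial_neq0 hF F_nontrivial.
  have x_gt0 : 0 < hnorm x.
    by rewrite lt_neqAle hnorm_ge0 andbT eq_sym; apply/eqP => /hnorm_eq0.
  rewrite -(pmulr_lge0 _ x_gt0).
  exact: le_trans (hnorm_ge0 _) (hnorm_gap x hG hG').
pose A := projector F \o projector G; pose B := projector F \o projector G'.
have AB x : hnorm (A x - B x) <= gap G G' * hnorm x.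
  apply: le_trans (hnorm_gap x hG hG').
  rewrite /A /B /= -scaleN1r addrC -(projector_linear hF) scaleN1r addrC.
  exact: hnorm_projector.
rewrite /hausdorff_dist ge_max !cos2_angles //.
apply/andP; split; apply: sup_dist_to_set_le => // u uP.
- apply: (approximate_spectrum_perturbation hF F_nontrivial
    (compression_selfadjoint hF hG') _ uP) => x _; exact: AB.
- apply: (approximate_spectrum_perturbation hF F_nontrivial
    (compression_selfadjoint hF hG) _ uP) => x _; rewrite hdistC; exact: AB.
Qed.
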